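(* For all integers $n\ge 0$, $k\ge 1$ and $\alpha\ge 1$ and all $x\in\mathbb{C}$, $$\widehat{C}_n^{(k)}(x)=\sum_{m=0}^{n}\left\{\sum_{l=0}^{n-m}\binom{n}{l}S_1(n-l,m)\,\widehat{C}_{l}^{(k+\alpha)}(\alpha)\right\}B_m^{(\alpha)}(x).$$
   Context: $(x)_n = x(x-1)\cdots(x-n+1)$ denotes the falling factorial, with $(x)_0=1$. For integers $k\ge1$, $n\ge0$, the higher-order Cauchy polynomials of the second kind (of order $k$) are $$\widehat{C}_n^{(k)}(x)=\int_0^1\cdots\int_0^1 (x-(x_1+\cdots+x_k))_n\,dx_1\cdots dx_k.$$ $S_1(n,l)$ are the signed Stirling numbers of the first kind, defined by $(x)_n=\sum_{l=0}^n S_1(n,l)x^l$. For an integer $\alpha\ge1$, the Bernoulli polynomials $B_n^{(\alpha)}(x)$ of order $\alpha$ are defined by $\left(\frac{t}{e^t-1}\right)^{\alpha}e^{xt}=\sum_{n=0}^\infty B_n^{(\alpha)}(x)\frac{t^n}{n!}$. *)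

(* Defs.v *)
From HB Require Import structures.
From mathcomp Require Import all_boot all_order all_algebra.
From mathcomp Require Import complex.
From mathcomp Require Import all_classical all_reals all_analysis.
Set Implicit Arguments.
Unset Strict Implicit.
Unset Printing Implicit Defensive.
Import Order.TTheory GRing.Theory Num.Theory.
Local Open Scope ring_scope.

Definition falling (A : comNzRingType) (x : A) (n : nat) : A :=
  \prod_(i < n) (x - i%:R).

Definition stirling1 (n l : nat) : int := (falling ('X : {poly int}) n)`_l.

(* Integral over [0, 1] of a complex-valued function, taken componentwise. *)
Definition cintegral01 (R : realType) (f : R -> R[i]) : R[i] :=
  Complex (\int[@lebesgue_measure R]_(t in `[0, 1]) complex.Re (f t))
          (\int[@lebesgue_measure R]_(t in `[0, 1]) complex.Im (f t)).

Fixpoint cube_integral (R : realType) (k : nat) :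
    (k.-tuple R -> R[i]) -> R[i] :=
  if k is k'.+1 then
    fun f => cintegral01 (fun t =>
      cube_integral (fun y : k'.-tuple R => f [tuple of t :: y]))
  else fun f => f [tuple].

Definition cauchy2 (R : realType) (k n : nat) (x : R[i]) : R[i] :=
  cube_integral (fun y : k.-tuple R =>
    falling (x - (\sum_(i < k) tnth y i)%:C%C) n).

(* Formal power series, represented by their sequences of coefficients. *)
Section FormalPowerSeries.
Variable F : numFieldType.
Implicit Types f g : nat -> F.

Definition fps_one : nat -> F := fun n => (n == 0%N)%:R.

Definition fps_X : nat -> F := fun n => (n == 1%N)%:R.

Definition fps_mul f g : nat -> F :=
  fun n => \sum_(i < n.+1) f i * g (n - i)%N.

Definition fps_pow f (a : nat) : nat -> F := iter a (fps_mul f) fps_one.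

(* The coefficients 0, ..., n of 1 / f, meaningful when f 0 != 0. *)
Fixpoint fps_inv_seq f (n : nat) : seq F :=
  if n is m.+1 then
    let s := fps_inv_seq f m in
    rcons s (- (f 0%N)^-1 * \sum_(i < m.+1) f i.+1 * s`_(m - i))
  else [:: (f 0%N)^-1].

Definition fps_inv f : nat -> F := fun n => (fps_inv_seq f n)`_n.

(* e^(xt) *)
Definition fps_exp (x : F) : nat -> F := fun n => x ^+ n / (n`!)%:R.

(* e^t - 1 *)
Definition fps_expm1 : nat -> F := fun n => fps_exp 1 n - fps_one n.

(* t / (e^t - 1), as the inverse of the series (e^t - 1) / t, whose constant
   coefficient is 1. *)
Definition fps_todd : nat -> F := fps_inv (fun n => fps_expm1 n.+1).

Definition bernoulli (a n : nat) (x : F) : F :=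
  (n`!)%:R * fps_mul (fps_pow fps_todd a) (fps_exp x) n.

Lemma size_fps_inv_seq f n : size (fps_inv_seq f n) = n.+1.
Proof. by elim: n => //= n IHn; rewrite size_rcons IHn. Qed.

Lemma nth_fps_inv_seq f n i : (i <= n)%N -> (fps_inv_seq f n)`_i = fps_inv f i.
Proof.
elim: n => [|n IHn]; first by case: i.
rewrite leq_eqVlt => /orP[/eqP-> //|lt_in].
by rewrite /= nth_rcons size_fps_inv_seq lt_in IHn.
Qed.

Lemma fps_mulV f : f 0%N != 0 -> fps_mul f (fps_inv f) =1 fps_one.
Proof.
move=> f0 [|n]; rewrite /fps_mul /fps_one.
  by rewrite big_ord1 /fps_inv /= mulfV.
rewrite big_ord_recl subn0 [X in _ * X]/fps_inv /= nth_rcons size_fps_inv_seq.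
rewrite ltnn eqxx mulNr mulrN mulrA mulfV // mul1r.
apply/eqP; rewrite addrC subr_eq0; apply/eqP/eq_bigr => i _.
by rewrite nth_fps_inv_seq ?leq_subr // /bump /= add1n subSS.
Qed.

Lemma fps_expm1_todd : fps_mul fps_expm1 fps_todd =1 fps_X.
Proof.
have e0 : fps_expm1 0 = 0.
  by rewrite /fps_expm1 /fps_exp /fps_one /= expr0 fact0 divr1 subrr.
have e1 : fps_expm1 1 != 0.
  by rewrite /fps_expm1 /fps_exp /fps_one /= expr1 divr1 subr0 oner_neq0.
move=> [|n]; rewrite {1}/fps_mul big_ord_recl e0 mul0r add0r.
  by rewrite big_ord0.
by rewrite -[RHS](@fps_mulV (fun n => fps_expm1 n.+1) e1 n).
Qed.

End FormalPowerSeries.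

(* Main.v *)
Require Import Defs.
From HB Require Import structures.
From mathcomp Require Import all_boot all_order all_algebra.
From mathcomp Require Import complex.
From mathcomp Require Import all_classical all_reals all_analysis.
From mathcomp Require Import ring.
Set Implicit Arguments.
Unset Strict Implicit.
Unset Printing Implicit Defensive.
Import Order.TTheory GRing.Theory Num.Theory.
Local Open Scope ring_scope.

(** The proof replaces generating functions by differential operators.
A formal power series [a] acts on polynomials by
  [a(D) p = \sum_j a_j p^(j)]
(a finite sum, [diffop]), the product of series acting as the composition of
operators. Three operators matter.
- The translation [p(X) |-> p(X + s)] is [e^(sD)]: this is Taylor's formula.
- The backward mean [I], sending [p] to the integral of [p(X - t)] over
  [0 <= t <= 1], is the operator of [(1 - e^(-t)) / t]. Iterating it,
  the Cauchy polynomial of order [k] is [I^k] applied to the falling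
  factorial [(X)_n] ([cauchy2E]).
- The forward mean [J], of series [(e^t - 1) / t], is [I] followed by the
  translation by 1. Its inverse is the operator of [t / (e^t - 1)], so that
  [J^(-alpha) X^m] is the Bernoulli polynomial of order [alpha] and index [m]
  ([bernoulliE]).

Put [P = I^k (X)_n]. Then [J^alpha P] is [I^(k+alpha) (X)_n] translated by
[alpha], whence
  [P = J^(-alpha) ((I^(k+alpha) (X)_n) (X + alpha))]   ([todd_mean_pow]).
Operators commute with translations, so the binomial identity
  [(x + y)_n = \sum_l 'C(n, l) (x)_l (y)_(n-l)]
gives ([diffop_falling_shift])
  [(I^(k+alpha) (X)_n) (X + alpha)
     = \sum_l 'C(n, l) (I^(k+alpha) (X)_l)(alpha) (X)_(n-l)].
Expanding [(X)_(n-l)] in powers of [X] by Stirling numbers and applying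
[J^(-alpha)] turns each [X^m] into a Bernoulli polynomial, which is the claim
after exchanging the sums over [l] and [m]. *)

(** * Double sums and polynomial functions *)

Lemma sum_triangle_exchange (V : nmodType) n (G : nat -> nat -> V) :
  \sum_(i < n.+1) \sum_(j < (n - i).+1) G i j =
  \sum_(j < n.+1) \sum_(i < (n - j).+1) G i j.
Proof.
have narrow (H : nat -> V) (i : 'I_n.+1) :
    \sum_(j < (n - i).+1) H j = \sum_(j < n.+1 | (i + j <= n)%N) H j.
  rewrite (big_ord_widen n.+1 H) ?ltnS ?leq_subr //.
  apply: eq_bigl => j; rewrite ltnS leq_subRL //; exact: (ltn_ord i).
under eq_bigr => i _ do rewrite narrow.
under [RHS]eq_bigr => j _ do rewrite (narrow (G^~ j)).
rewrite (exchange_big_dep predT) //=; apply: eq_bigr => j _.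
by apply: eq_bigl => i; rewrite addnC.
Qed.

Lemma sum_diagonals (V : nmodType) n (G : nat -> nat -> V) :
  \sum_(k < n) \sum_(i < k.+1) G i (k - i)%N =
  \sum_(i < n) \sum_(j < n - i) G i j.
Proof.
have narrow (k : 'I_n) :
    \sum_(i < k.+1) G i (k - i)%N = \sum_(i < n | (i <= k)%N) G i (k - i)%N.
  by rewrite (big_ord_widen n (fun i => G i (k - i)%N)) ?ltn_ord.
under eq_bigr => k _ do rewrite narrow.
rewrite (exchange_big_dep predT) //=; apply: eq_bigr => i _.
rewrite -(big_geq_mkord i n predT (fun k => G i (k - i)%N)).
rewrite -(big_mkord predT (G i)) -{1}(add0n (i : nat)) big_addn.
by apply: eq_big_nat => j _; rewrite addnK.
Qed.

Lemma eq_poly_horner (F : numDomainType) (p q : {poly F}) :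
  (forall x, p.[x] = q.[x]) -> p = q.
Proof.
move=> pq; apply/eqP; rewrite -subr_eq0; apply/eqP.
apply: (@roots_geq_poly_eq0 _ _ [seq i%:R | i <- iota 0 (size (p - q))]).
- by apply/allP => x _; rewrite rootE hornerD hornerN pq subrr.
- rewrite map_inj_uniq ?iota_uniq // => i j /eqP.
  by rewrite eqr_nat => /eqP.
- by rewrite size_map size_iota.
Qed.

(** * Power series acting as differential operators *)

Section DifferentialOperators.
Variable F : numFieldType.
Implicit Types (a b c : nat -> F) (p q : {poly F}).

(** The sum stops at [size p] because the later derivatives vanish. *)
Definition diffop a p := \sum_(j < size p) a j *: p^`(j).

Lemma diffop_widen N a p :
  (size p <= N)%N -> diffop a p = \sum_(j < N) a j *: p^`(j).
Proof.
move=> pN; rewrite /diffop (big_ord_widen N (fun j => a j *: p^`(j))) //.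
rewrite big_mkcond; apply: eq_bigr => j _.
by case: ltnP => // /derivn_poly0 ->; rewrite scaler0.
Qed.

Lemma diffop_is_linear a : linear (diffop a).
Proof.
move=> s p q; pose N := maxn (size (s *: p + q)) (maxn (size p) (size q)).
rewrite !(@diffop_widen N) ?leq_max ?leqnn ?orbT //.
rewrite scaler_sumr -big_split; apply: eq_bigr => j _ /=.
by rewrite derivnD derivnZ scalerDr !scalerA mulrC.
Qed.

HB.instance Definition _ a :=
  GRing.isLinear.Build F {poly F} {poly F} *:%R (diffop a) (diffop_is_linear a).

Lemma eq_diffop a b p : a =1 b -> diffop a p = diffop b p.
Proof. by move=> ab; apply: eq_bigr => j _; rewrite ab. Qed.

Lemma size_derivn_le p j : (size p^`(j) <= size p)%N.
Proof.
apply/leq_sizeP => i le_pi; rewrite coef_derivn nth_default ?mul0rn //.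
exact: leq_trans le_pi (leq_addl _ _).
Qed.

Lemma size_diffop a p : (size (diffop a p) <= size p)%N.
Proof.
apply: (leq_trans (size_sum _ _ _)); apply/bigmax_leqP => j _.
exact: leq_trans (size_scale_leq _ _) (size_derivn_le _ _).
Qed.

Lemma derivn_derivn p i j : p^`(j)^`(i) = p^`(i + j).
Proof. by rewrite /derivn -iterD. Qed.

Lemma diffop_derivn a p j : diffop a p^`(j) = (diffop a p)^`(j).
Proof.
rewrite (@diffop_widen (size p)) ?size_derivn_le // /diffop linear_sum /=.
by apply: eq_bigr => i _; rewrite derivnZ !derivn_derivn addnC.
Qed.

(** By linearity, since [a(D)] commutes with each derivative. *)
Lemma diffopC a b p : diffop a (diffop b p) = diffop b (diffop a p).
Proof.
rewrite [RHS](@diffop_widen (size p)) ?size_diffop // {1}/(diffop b) linear_sum.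
by apply: eq_bigr => j _; rewrite linearZ /= diffop_derivn.
Qed.

Lemma diffop_one p : diffop (@fps_one F) p = p.
Proof.
rewrite (@diffop_widen (size p).+1) // big_ord_recl big1 ?addr0 ?scale1r //.
by move=> i _; rewrite /fps_one scale0r.
Qed.

(** The coefficient of [p^(i + j)] is [a_i b_j] on both sides. Composition only
yields the terms with [i, j < size p] and the product those with
[i + j < size p]; the difference consists of vanishing derivatives. *)
Lemma diffop_mul a b p : diffop (fps_mul a b) p = diffop a (diffop b p).
Proof.
pose G i j := (a i * b j) *: p^`(i + j).
transitivity (\sum_(i < size p) \sum_(j < size p - i) G i j).
  rewrite -sum_diagonals; apply: eq_bigr => k _.
  rewrite scaler_suml; apply: eq_bigr => i _.
  by rewrite /G subnKC // -ltnS.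
rewrite (@diffop_widen (size p)) ?size_diffop //; apply: eq_bigr => i _.
rewrite /diffop linear_sum scaler_sumr /=.
rewrite (big_ord_widen _ (G i) (leq_subr i _)) big_mkcond.
apply: eq_bigr => j _; rewrite derivnZ scalerA derivn_derivn -/(G i j).
case: ifPn => //; rewrite -leqNgt leq_subLR => le_p.
by rewrite /G derivn_poly0 ?scaler0.
Qed.

Lemma diffop_powD a m n p :
  diffop (fps_pow a (m + n)) p = diffop (fps_pow a m) (diffop (fps_pow a n) p).
Proof.
elim: m => [|m IHm]; first by rewrite diffop_one.
by rewrite addSn !diffop_mul IHm.
Qed.

(** Powers of a product of operators, the factors being moved past each other by
[diffopC]. *)
Lemma diffop_powM a b c n p :
    fps_mul a b =1 c ->
  diffop (fps_pow a n) (diffop (fps_pow b n) p) = diffop (fps_pow c n) p.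
Proof.
move=> abc; elim: n => [|n IHn]; first by rewrite !diffop_one.
rewrite !diffop_mul (diffopC _ b) IHn -diffop_mul.
exact: eq_diffop.
Qed.

Lemma diffop_pow_one n p : diffop (fps_pow (@fps_one F) n) p = p.
Proof. by elim: n => [|n IHn]; rewrite ?diffop_mul ?IHn diffop_one. Qed.

(** Taylor's formula, read in the ring of polynomials: the value of [p] at
['X + s]. *)
Lemma diffop_exp s p : diffop (fps_exp s) p = p \Po ('X + s%:P).
Proof.
rewrite /comp_poly nderiv_taylor; last exact: mulrC.
rewrite size_map_poly; apply: eq_bigr => j _.
rewrite nderivn_map -/(comp_poly 'X _) comp_polyXr nderivn_def /fps_exp.
rewrite -[RHS]mulrC -polyC_exp mul_polyC -scaler_nat scalerA.
by rewrite divfK // pnatr_eq0 -lt0n fact_gt0.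
Qed.

Lemma diffop_exp_pow (s : F) n p :
  diffop (fps_pow (fps_exp s) n) p = p \Po ('X + (s *+ n)%:P).
Proof.
elim: n p => [|n IHn] p.
  by rewrite diffop_one mulr0n addr0 comp_polyXr.
rewrite diffop_mul IHn diffop_exp -comp_polyA.
by rewrite comp_polyD comp_polyX comp_polyC -addrA -polyCD mulrS.
Qed.

(** * The mean operators and the Bernoulli polynomials *)

(** The series [(e^t - 1) / t], whose operator sends [p] to the integral of
[p(X + t)] over [0 <= t <= 1]. *)
Definition forward_mean : nat -> F := fun j => fps_expm1 F j.+1.

(** The series [(1 - e^(-t)) / t], whose operator sends [p] to the integral of
[p(X - t)] over [0 <= t <= 1]. *)
Definition backward_mean : nat -> F := fun j => (-1) ^+ j / (j.+1)`!%:R.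

Lemma forward_mean_todd : fps_mul forward_mean (@fps_todd F) =1 @fps_one F.
Proof.
apply: fps_mulV.
rewrite /forward_mean /fps_expm1 /fps_exp /fps_one /= expr1 divr1 subr0.
exact: oner_neq0.
Qed.

(** Multiplied by [(n + 1)!], the coefficients of degree [n] give
[\sum_(i <= n) (-1)^(n - i) 'C(n + 1, i) = 1], which is the expansion of
[(-1 + 1)^(n + 1)] without its last term. *)
Lemma exp_backward_mean :
  fps_mul (fps_exp 1) backward_mean =1 forward_mean.
Proof.
move=> n; have fact_neq0 m : m`!%:R != 0 :> F.
  by rewrite pnatr_eq0 -lt0n fact_gt0.
rewrite /forward_mean /fps_expm1 /fps_mul /fps_exp /fps_one subr0.
apply: (mulIf (fact_neq0 n.+1)); rewrite divfK // expr1n mulr_suml.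
have := exprDn (-1 : F) 1 n.+1; rewrite addNr expr0n big_ord_recr /=.
rewrite subnn binn mulr1n expr0 expr1n mulr1 => /eqP; rewrite eq_sym addr_eq0.
move=> /eqP sumE; rewrite -[RHS]opprK -sumE -sumrN; apply: eq_bigr => i _.
have le_in : (i <= n.+1)%N by apply: ltnW; exact: ltn_ord.
rewrite !expr1n mulr1 mul1r -mulr_natr -[n.+1`!](bin_fact le_in) /backward_mean.
rewrite subSn -1?ltnS // exprS mulN1r.
rewrite (natrM _ 'C(_, _)) (natrM _ i`!).
move: (fact_neq0 i) (fact_neq0 (n - i).+1).
move: (i`!%:R) (_.+1`!%:R) => u v u_neq0 v_neq0.
by field; rewrite u_neq0 v_neq0.
Qed.

Lemma bernoulliE n m (x : F) :
  bernoulli n m x = (diffop (fps_pow (@fps_todd F) n) 'X^m).[x].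
Proof.
rewrite /diffop size_polyXn horner_sum /bernoulli /fps_mul mulr_sumr.
apply: eq_bigr => j _; rewrite derivnXn hornerZ hornerMn hornerXn /fps_exp.
rewrite -mulr_natl !mulrA mulrC.
have le_jm : (j <= m)%N by rewrite -ltnS.
rewrite -(ffact_fact le_jm) natrM.
by field; rewrite pnatr_eq0 -lt0n fact_gt0.
Qed.

(** The operator form of [((1 - e^(-t)) / t) * t = 1 - e^(-t)]. It identifies
the operator with the integral of [q(x - t)] over [0 <= t <= 1], where
[q = p']. *)
Lemma diffop_backward_mean_deriv p x :
  (diffop backward_mean p^`()).[x] = p.[x] - p.[x - 1].
Proof.
have <- : (p \Po ('X + (-1)%:P)).[x] = p.[x - 1].
  by rewrite horner_comp hornerD hornerX hornerC.
rewrite -diffop_exp (@diffop_widen (size p).+1 (fps_exp _)) // big_ord_recl.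
rewrite {1}/fps_exp expr0 divr1 scale1r hornerD opprD addNKr.
rewrite (@diffop_widen (size p)) ?(size_derivn_le p 1) //.
rewrite -hornerN -sumrN; congr horner; apply: eq_bigr => j _.
by rewrite -derivSn /fps_exp /backward_mean exprS mulN1r mulNr scaleNr opprK.
Qed.

Lemma poly_antiderivative p : {P : {poly F} | P^`() = p}.
Proof.
exists (\poly_(i < (size p).+1) (p`_i.-1 / i%:R)).
apply/polyP => i; rewrite coef_deriv coef_poly ltnS.
case: ltnP => [_ | le_pi]; last by rewrite nth_default ?mul0rn.
by rewrite -[LHS]mulr_natr divfK // pnatr_eq0.
Qed.

(** Here [I^k p = J^(-n) J^n I^k p], and [J^n I^k] is the translate of [I^(k+n)]
by [n]. *)
Lemma todd_mean_pow k n p :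
  diffop (fps_pow backward_mean k) p =
  diffop (fps_pow (@fps_todd F) n)
    (diffop (fps_pow backward_mean (k + n)) p \Po ('X + n%:R%:P)).
Proof.
rewrite -diffop_exp_pow (addnC k) diffop_powD.
rewrite (diffop_powM _ _ exp_backward_mean) diffopC.
by rewrite (diffop_powM _ _ forward_mean_todd) diffop_pow_one.
Qed.

End DifferentialOperators.

(** * Falling factorials *)

Lemma rmorph_falling (A B : comNzRingType) (f : {rmorphism A -> B}) x n :
  f (falling x n) = falling (f x) n.
Proof.
by rewrite rmorph_prod; apply: eq_bigr => i _; rewrite rmorphB rmorph_nat.
Qed.

Lemma fallingS (A : comNzRingType) (x : A) n :
  falling x n.+1 = falling x n * (x - n%:R).
Proof. exact: big_ord_recr. Qed.

Lemma horner_falling (A : comNzRingType) (q : {poly A}) x n :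
  (falling q n).[x] = falling q.[x] n.
Proof. by rewrite -[LHS]/(horner_eval x _) rmorph_falling. Qed.

Lemma comp_falling (A : comNzRingType) (q : {poly A}) n :
  falling 'X n \Po q = falling q n.
Proof. by rewrite rmorph_falling /= comp_polyX. Qed.

(** Induction as for the binomial theorem, the new factor being split as
[x + y - n = (x - l) + (y - (n - l))] in the term of index [l]. *)
Lemma fallingD (A : comNzRingType) (x y : A) n :
  falling (x + y) n =
  \sum_(l < n.+1) 'C(n, l)%:R * falling x l * falling y (n - l).
Proof.
elim: n => [|n IHn]; first by rewrite big_ord1 /falling !big_ord0 !mulr1.
rewrite fallingS IHn mulr_suml.
have split_last (l : 'I_n.+1) : x + y - n%:R = (x - l%:R) + (y - (n - l)%:R).
  by rewrite natrB; [ring | rewrite -ltnS].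
pose G l := 'C(n, l)%:R * falling x l * falling y (n.+1 - l).
transitivity (\sum_(l < n.+1) 'C(n, l)%:R * falling x l.+1 * falling y (n - l)
              + \sum_(l < n.+2) G l).
  have G_last : G n.+1 = 0 by rewrite /G bin_small // !mul0r.
  rewrite [X in _ = _ + X]big_ord_recr /= G_last addr0.
  rewrite -big_split; apply: eq_bigr => l _ /=.
  by rewrite (split_last l) /G subSn -1?ltnS // !fallingS; ring.
rewrite [X in _ + X = _]big_ord_recl [in RHS]big_ord_recl addrCA; congr (_ + _).
  by rewrite /G !bin0.
rewrite -big_split; apply: eq_bigr => l _ /=.
by rewrite /G /bump add1n subSS binS natrD; ring.
Qed.

Lemma falling_stirling1 (A : comNzRingType) n :
  falling ('X : {poly A}) n = \sum_(m < n.+1) (stirling1 n m)%:~R *: 'X^m.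
Proof.
have size_falling : (size (falling ('X : {poly int}) n) <= n.+1)%N.
  rewrite /falling; under eq_bigr => i _ do rewrite -polyC_natr.
  rewrite -(big_mkord predT (fun i => 'X - i%:R%:P)).
  by rewrite size_prod_XsubC size_iota subn0.
rewrite -(poly_def _ (fun m => (stirling1 n m)%:~R)).
rewrite -(map_polyX (intr : int -> A)) -rmorph_falling.
apply/polyP => m; rewrite coef_map coef_poly; case: ltnP => // lt_nm.
by rewrite nth_default ?(leq_trans size_falling).
Qed.

(** The polynomial identity is checked at every point [y]: there the left side
is [a(D) (X)_n] at [y + s], that is [a(D) (X + y)_n] at [s], and [(X + y)_n]
is a combination of the [(X)_l] with coefficients depending on [y]. *)
Lemma diffop_falling_shift (F : numFieldType) (a : nat -> F) n (s : F) :
  diffop a (falling 'X n) \Po ('X + s%:P) =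
  \sum_(l < n.+1)
    ('C(n, l)%:R * (diffop a (falling 'X l)).[s]) *: falling 'X (n - l).
Proof.
apply: eq_poly_horner => y; rewrite horner_comp hornerD hornerX hornerC.
have -> : (diffop a (falling 'X n)).[y + s] =
          (diffop a (falling 'X n) \Po ('X + y%:P)).[s].
  by rewrite horner_comp hornerD hornerX hornerC addrC.
rewrite -diffop_exp diffopC diffop_exp comp_falling fallingD.
rewrite linear_sum !horner_sum.
apply: eq_bigr => l _; rewrite hornerZ.
have -> : 'C(n, l)%:R * falling 'X l * falling y%:P (n - l) =
  ('C(n, l)%:R * falling y (n - l)) *: falling 'X l :> {poly F}.
  by rewrite -rmorph_falling -mul_polyC polyCM polyC_natr mulrAC.
by rewrite linearZ hornerZ horner_falling hornerX mulrAC.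
Qed.

(** * Integrals of polynomials over the unit cube *)

Section UnitIntegral.
Import numFieldNormedType.Exports.
Variable R : realType.

Lemma Rintegral01_deriv (p : {poly R}) :
  \int[@lebesgue_measure R]_(t in `[0, 1]) p^`().[t] = p.[1] - p.[0].
Proof.
rewrite /Rintegral (@continuous_FTC2 _ (horner p^`()) (horner p)) //.
- by apply: continuous_subspaceT; exact: continuous_horner.
- split; first by move=> t _; exact: derivable_horner.
    by apply: cvg_at_right_filter; exact: continuous_horner.
  by apply: cvg_at_left_filter; exact: continuous_horner.
- by move=> t _; rewrite derivE.
Qed.

(** The real and imaginary parts of [p(t)], for real [t], are the values of the
real polynomials whose coefficients are the parts of those of [p]. Both parts
are treated at once, as an additive map [f] that is linear over the reals. *)
Lemma cintegral01_deriv (p : {poly R[i]}) :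
  cintegral01 (fun t => p^`().[t%:C%C]) = p.[1] - p.[0].
Proof.
have part_deriv (f : {additive R[i] -> R}) :
    (forall z (t : R), f (z * t%:C%C) = f z * t) ->
  \int[@lebesgue_measure R]_(t in `[0, 1]) f p^`().[t%:C%C] = f (p.[1] - p.[0]).
  move=> fM; pose fp := map_poly f p.
  have fpE (q : {poly R[i]}) (t : R) : (map_poly f q).[t] = f q.[t%:C%C].
    rewrite (horner_coef_wide _ (size_poly _ _)) horner_coef raddf_sum.
    apply: eq_bigr => i _; rewrite -rmorphXn /= fM.
    by rewrite coef_map_id0 ?raddf0.
  have fp' : map_poly f p^`() = fp^`().
    apply/polyP => i.
    by rewrite coef_deriv !coef_map_id0 ?raddf0 // coef_deriv raddfMn.
  under eq_Rintegral => t _ do rewrite -fpE fp'.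
  by rewrite Rintegral01_deriv !fpE -raddfB.
rewrite /cintegral01 (part_deriv (@complex.Re R)) ?(part_deriv (@complex.Im R)).
- by case: (p.[1] - p.[0]).
- by move=> [u v] t; rewrite /= mulr0 add0r mulrC.
- by move=> [u v] t; rewrite /= mulr0 subr0.
Qed.

Lemma cintegral01_shift (p : {poly R[i]}) x :
  cintegral01 (fun t => p.[x - t%:C%C]) = (diffop (backward_mean R[i]) p).[x].
Proof.
have [P <-] := poly_antiderivative p.
rewrite diffop_backward_mean_deriv.
(* The polynomial [t |-> - P(x - t)] has derivative [P'(x - t)] *)
pose Q := - (P \Po (x%:P - 'X)).
have QE z : Q.[z] = - P.[x - z] by rewrite /Q hornerN horner_comp !hornerE.
have Q'E z : Q^`().[z] = P^`().[x - z].
  rewrite /Q derivN deriv_comp derivB derivC derivX sub0r mulrN1 opprK.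
  by rewrite horner_comp !hornerE.
have -> : (fun t : R => P^`().[x - t%:C%C]) = (fun t => Q^`().[t%:C%C]).
  by apply/funext => t; rewrite Q'E.
by rewrite cintegral01_deriv !QE subr0 opprK addrC.
Qed.

(** Integrating over one coordinate after the other, each integral applies the
backward mean once more to the polynomial left by the inner ones. *)
Lemma cube_integral_shift k (p : {poly R[i]}) x :
  cube_integral (fun y : k.-tuple R => p.[x - (\sum_(i < k) tnth y i)%:C%C]) =
  (diffop (fps_pow (backward_mean R[i]) k) p).[x].
Proof.
elim: k x => [|k IHk] x; first by rewrite /= big_ord0 subr0 diffop_one.
rewrite diffop_mul -cintegral01_shift /=; congr cintegral01; apply/funext => t.
rewrite -IHk; congr cube_integral; apply/funext => y.
rewrite big_ord_recl tnth0 rmorphD opprD addrA /=.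
by under eq_bigr => i _ do rewrite tnthS.
Qed.

Lemma cauchy2E k n (x : R[i]) :
  cauchy2 k n x =
  (diffop (fps_pow (backward_mean R[i]) k) (falling 'X n)).[x].
Proof.
rewrite -cube_integral_shift; congr cube_integral; apply/funext => y.
by rewrite horner_falling hornerX.
Qed.

End UnitIntegral.

(** * The expansion in Bernoulli polynomials *)

Theorem theorem3p3 (R : realType) (n k alpha : nat)
    (hk : (1 <= k)%N) (halpha : (1 <= alpha)%N) (x : R[i]) :
  cauchy2 k n x =
  \sum_(m < n.+1)
    (\sum_(l < (n - m).+1)
       'C(n, l)%:R * (stirling1 (n - l) m)%:~R
         * cauchy2 (k + alpha) l (alpha%:R : R[i]))
    * bernoulli alpha m x.
Proof.
pose c l := cauchy2 (k + alpha) l (alpha%:R : R[i]).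
pose G l m :=
  'C(n, l)%:R * (stirling1 (n - l) m)%:~R * c l * bernoulli alpha m x.
transitivity (\sum_(l < n.+1) \sum_(m < (n - l).+1) G l m); last first.
  rewrite sum_triangle_exchange; apply: eq_bigr => m _.
  by rewrite mulr_suml.
rewrite cauchy2E (todd_mean_pow k alpha) diffop_falling_shift.
rewrite linear_sum horner_sum; apply: eq_bigr => l _.
rewrite linearZ hornerZ -cauchy2E -/(c l) falling_stirling1 linear_sum.
rewrite horner_sum mulr_sumr; apply: eq_bigr => m _.
by rewrite linearZ hornerZ -bernoulliE /G mulrA (mulrAC _ (c l)).
Qed.
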